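(* Let $(K_n)_{n\ge 0}$ be the Tribonacci-Lucas sequence: $K_0=3$, $K_1=1$, $K_2=3$ and $K_n=K_{n-1}+K_{n-2}+K_{n-3}$ for $n\ge 3$. Then for every integer $n\ge 0$: (a) $\sum_{k=0}^{n}K_{k}=\frac{1}{2}(K_{n+3}-K_{n+1}).$ (b) $\sum_{k=0}^{n}K_{2k}=\frac{1}{2}(K_{2n+1}+K_{2n}+2).$ (c) $\sum_{k=0}^{n}K_{2k+1}=\frac{1}{2}(K_{2n+2}+K_{2n+1}-2).$ *)

(* Defs.v *)
From mathcomp Require Import all_boot all_order all_algebra.
Set Implicit Arguments.
Unset Strict Implicit.
Unset Printing Implicit Defensive.
Import GRing.Theory.
Local Open Scope ring_scope.

Fixpoint tribonacci_lucas (n : nat) : int :=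
  match n with
  | 0 => 3
  | 1 => 1
  | 2 => 3
  | ((m.+1 as m1).+1 as m2).+1 =>
      tribonacci_lucas m2 + tribonacci_lucas m1 + tribonacci_lucas m
  end.

(* Main.v *)
Require Import Defs.
From mathcomp Require Import all_boot all_order all_algebra.
From mathcomp Require Import ring.
Set Implicit Arguments.
Unset Strict Implicit.
Unset Printing Implicit Defensive.
Import GRing.Theory.
Local Open Scope ring_scope.

(* Twice each summand is the increment of twice the closed form, by the
   recurrence alone; the initial values only fix the additive constants. *)

(** Telescoping: [K (m+3) - K (m+2) - K (m+1) + K m = 2 * K m] drives (a), and [K (m+3) + K (m+2) -
    K (m+1) - K m = 2 * K (m+2)] drives (b) at [m = 2n] and (c) at [m = 2n+1]. *)

Lemma tribonacci_lucasS3 (n : nat) :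
  tribonacci_lucas n.+3 =
  tribonacci_lucas n.+2 + tribonacci_lucas n.+1 + tribonacci_lucas n.
Proof. by []. Qed.

Theorem corollary2p4 (n : nat) :
  let K (m : nat) : rat := (tribonacci_lucas m)%:~R in
  [/\ \sum_(0 <= k < n.+1) K k = 1 / 2 * (K (n + 3)%N - K (n + 1)%N),
      \sum_(0 <= k < n.+1) K (2 * k)%N
        = 1 / 2 * (K (2 * n + 1)%N + K (2 * n)%N + 2)
    & \sum_(0 <= k < n.+1) K (2 * k + 1)%N
        = 1 / 2 * (K (2 * n + 2)%N + K (2 * n + 1)%N - 2)].
Proof.
move=> K.
have KS3 m : K m.+3 = K m.+2 + K m.+1 + K m.
  by rewrite /K tribonacci_lucasS3 !rmorphD.
split.
(* The base case evaluates to [3 = (7 - 1) / 2]. *)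
- rewrite addn3 addn1; elim: n => [|n IHn]; first by rewrite big_nat1.
  by rewrite big_nat_recr //= IHn (KS3 n.+1) (KS3 n); field.
- rewrite addn1; elim: n => [|n IHn]; first by rewrite big_nat1.
  (* [mulnS] and [add2n] expose [2 * n.+1] as [(2 * n).+2], the form [KS3] needs. *)
  by rewrite big_nat_recr //= IHn mulnS add2n (KS3 (2 * n)%N); field.
- rewrite addn1 addn2; elim: n => [|n IHn]; first by rewrite big_nat1.
  rewrite big_nat_recr //= IHn mulnS add2n addn1.
  by rewrite (KS3 (2 * n).+1); field.
Qed.
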